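(* Let $f:\mathbb{R}^d\to\mathbb{R}$ be differentiable with a global minimizer $w_*$, and assume that $f$ is $L$-smooth ($L>0$) and $\rho$-quasar convex ($\rho>0$) with respect to $w_*$. Consider the discrete-time algorithm with parameters $\tau_k=1-\left(\frac{T_k}{T_{k+1}}\right)^{2/\rho}$, $\tau'_k=0$, $\tilde\gamma_k=\frac1L$, $\tilde\gamma'_k=\frac{\rho T_k}{2L}$. Then for every $k\ge1$, every $c\in(0,1)$ and every $c_0>1$, with probability at least $1-\frac{1}{c^2k}-\frac1{c_0}$, $$f(\tilde w_k)-f(w_* )\le\frac{2c_0L\|\tilde z_0-w_*\|^2}{(1-c)^2\rho^2k^2}.$$
   Context: Norms and inner products on $\mathbb{R}^d$ are Euclidean. $f$ is $L$-smooth if $f(x)\le f(y)+\langle\nabla f(y),x-y\rangle+\frac L2\|x-y\|^2$ for all $x,y\in\mathbb{R}^d$. $f$ is $\rho$-quasar convex with respect to the global minimizer $w_*$ if $f(w_* )\ge f(w)+\frac1\rho\langle\nabla f(w),w_*-w\rangle$ for all $w\in\mathbb{R}^d$. Random times: $T_0=0<T_1<T_2<\cdots$, where the increments $T_1,T_2-T_1,T_3-T_2,\dots$ are i.i.d. exponential random variables with mean $1$. Probability is with respect to these random times. Discrete-time algorithm: given (possibly random) parameters and deterministic initial points $\tilde w_0,\tilde z_0\in\mathbb{R}^d$, for $k=0,1,2,\dots$: $$\tilde v_k=\tilde w_k+\tau_k(\tilde z_k-\tilde w_k),\quad \tilde w_{k+1}=\tilde v_k-\tilde\gamma_{k+1}\nabla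 f(\tilde v_k),\quad \tilde z_{k+1}=\tilde z_k+\tau'_k(\tilde v_k-\tilde z_k)-\tilde\gamma'_{k+1}\nabla f(\tilde v_k).$$ *)

(* Defs.v *)
From HB Require Import structures.
From mathcomp Require Import all_boot all_order all_algebra.
From mathcomp Require Import all_classical all_reals all_analysis.
Set Implicit Arguments.
Unset Strict Implicit.
Unset Printing Implicit Defensive.
Import Order.TTheory GRing.Theory Num.Theory.
Import numFieldNormedType.Exports.
Local Open Scope classical_set_scope.
Local Open Scope ring_scope.

(* The library norm `|x| on 'rV[R]_n is the sup norm, hence the Euclidean inner
   product and norm below.  The topology, and so differentiability, does not
   depend on this choice. *)
Definition dotv (R : realType) (n : nat) (x y : 'rV[R]_n) : R :=
  \sum_(i < n) x 0 i * y 0 i.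

Definition enorm (R : realType) (n : nat) (x : 'rV[R]_n) : R :=
  Num.sqrt (dotv x x).

Definition grad (R : realType) (n : nat) (f : 'rV[R]_n -> R) (x : 'rV[R]_n) :
    'rV[R]_n :=
  \row_(i < n) 'D_(delta_mx 0 i) f x.

Definition smooth (R : realType) (n : nat) (L : R) (f : 'rV[R]_n -> R) : Prop :=
  forall x y : 'rV[R]_n,
    f x <= f y + dotv (grad f y) (x - y) + L / 2 * enorm (x - y) ^+ 2.

Definition global_minimizer (R : realType) (n : nat) (f : 'rV[R]_n -> R)
    (ws : 'rV[R]_n) : Prop :=
  forall w : 'rV[R]_n, f ws <= f w.

Definition quasar_convex (R : realType) (n : nat) (rho : R)
    (f : 'rV[R]_n -> R) (ws : 'rV[R]_n) : Prop :=
  forall w : 'rV[R]_n, f ws >= f w + rho^-1 * dotv (grad f w) (ws - w).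

Definition independent_RVs (dO dE : measure_display) (Omega : measurableType dO)
    (E : measurableType dE) (R : realType) (P : probability Omega R)
    (X : nat -> Omega -> E) : Prop :=
  forall (s : seq nat) (A : nat -> set E),
    uniq s -> (forall i, measurable (A i)) ->
    P (\bigcap_(i in [set` s]) (X i @^-1` A i)) =
      (\prod_(i <- s) P (X i @^-1` A i))%E.

(* The exponential law of mean 1 is the one of rate 1. *)
Definition exponential_times (dO : measure_display) (Omega : measurableType dO)
    (R : realType) (P : probability Omega R) (T : nat -> {RV P >-> R}) : Prop :=
  [/\ forall om, T 0%N om = 0,
      forall k om, T k om < T k.+1 om,
      independent_RVs P (fun k om => T k.+1 om - T k om) &
      forall k (A : set R), measurable A ->
        P ((fun om => T k.+1 om - T k om) @^-1` A) = exponential_prob 1 A].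

(* gamma 0 and gamma' 0 are never used: step k uses gamma k.+1 and gamma' k.+1. *)
Definition discrete_algorithm (R : realType) (n : nat) (f : 'rV[R]_n -> R)
    (tau tau' gamma gamma' : nat -> R) (w0 z0 : 'rV[R]_n)
    (v w z : nat -> 'rV[R]_n) : Prop :=
  [/\ w 0%N = w0, z 0%N = z0 &
      forall k : nat,
        [/\ v k = w k + tau k *: (z k - w k),
            w k.+1 = v k - gamma k.+1 *: grad f (v k) &
            z k.+1 = z k + tau' k *: (v k - z k)
                         - gamma' k.+1 *: grad f (v k)]].

(* Main.v *)
Require Import Defs.
From HB Require Import structures.
From mathcomp Require Import all_boot all_order all_algebra.
From mathcomp Require Import all_classical all_reals all_analysis.
From mathcomp Require Import measurable_realfun ring lra.
Import Order.TTheory GRing.Theory Num.Theory.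
Import numFieldNormedType.Exports.
Local Open Scope classical_set_scope.
Local Open Scope ring_scope.

(** The discrete algorithm is a continuous-time process observed at the
    arrival times of a Poisson process.  Between two arrivals, [w] slides
    towards [z] along the curve
    [v t = w + (1 - (T / t) `^ (2 / rho)) *: (z - w)], whose velocity is
    [2 / (rho * t) *: (z - v t)]; at an arrival, a gradient step is made.  The
    energy
    [t ^+ 2 * (f w - f ws) + 2 * L / rho ^+ 2 * `|z - ws| ^+ 2]
    is a supermartingale along the arrivals, for the following reason.

    Put [h t = t ^+ 2 * (f (v t) - f ws)] and let [C] be the second term of the
    energy at the current state.  Smoothness makes the step of length [1 / L]
    decrease [f] by at least [`|grad f v| ^+ 2 / (2 * L)], which cancels the
    quadratic term created by the step of [z]; what is left after an arrival
    at time [t] is at most [C + h t - h^`() t] once quasar convexity has been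
    applied ([lyapunov_step_le], [is_derive_sqr_gap]).  The waiting time is
    exponential, and
    [expR (- s) * (q s - q^`() s)] is the derivative of [- expR (- s) * q s],
    so that the mean of the new energy is at most [C + h] at the current time,
    which is the current energy ([lyapunov_drift]).  Only the inequality
    half of the fundamental theorem of calculus is used here; it follows from
    Fatou's lemma for monotone functions, without any study of the continuity
    of the gradient
    ([integral_derive_le], [exponential_average_le]).

    The next state is a function of the current state and of a fresh waiting
    time.  By induction the state is independent of all later waiting times
    ([indep_iterated]), so Tonelli's theorem turns the pointwise estimate into
    an inequality between expectations ([iterated_drift_le]).  Since the energy
    starts at [2 * L / rho ^+ 2 * `|z0 - ws| ^+ 2], it has at most this mean at
    every step.  The same scheme applied to [(t - k) ^+ 2] bounds the mean of
    [(T k - k) ^+ 2] by [k].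

    Markov's inequality for these two quantities leaves an event of
    probability at least [1 - 1 / (c ^+ 2 * k) - 1 / c0] on which
    [T k >= (1 - c) * k] and
    [T k ^+ 2 * (f (w k) - f ws) <= c0 * (2 * L / rho ^+ 2 * `|z0 - ws| ^+ 2)];
    dividing gives the claim ([gap_le_lyapunov]). *)

(** * Averages against the exponential density *)

Section ExponentialAverage.
Local Set Implicit Arguments.
Local Unset Strict Implicit.

Lemma cvg_harmonic_dnbhs (R : realType) : @harmonic R n @[n --> \oo] --> (0 : R)^'.
Proof.
move=> A; rewrite /dnbhs /within /= => /(cvg_harmonic (R := R)) hA.
have {}hA : \forall n \near \oo, @harmonic R n != 0 -> A (harmonic n) := hA.
suff : \forall n \near \oo, A (@harmonic R n) by [].
by apply: filterS hA => n; apply; rewrite /= invr_eq0 pnatr_eq0.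
Qed.

Lemma derive_harmonic_cvg (R : realType) (V : normedModType R) (f : V -> R)
    (x d : V) : derivable f x d ->
  (f (x + harmonic n *: d) - f x) * n.+1%:R @[n --> \oo] --> 'D_d f x.
Proof.
move=> /derivableP[] df _; have := cvg_comp _ _ (@cvg_harmonic_dnbhs R) df.
rewrite (_ : _ \o _ = fun n => (f (x + harmonic n *: d) - f x) * n.+1%:R).
  by [].
by apply/funext => n /=; rewrite invrK [_ *: d + x]addrC [LHS]mulrC.
Qed.

(** A primitive [K] of the increment exists because [F] is continuous; the
    integral telescopes to the difference of the integrals of [F] over
    [[b, b + h]] and over [[a, a + h]], and the mean value theorem evaluates
    both. *)
Lemma integral_increment_le (R : realType) (F : R -> R) (a b h : R) :
  a < b -> continuous F -> {homo F : x y / x <= y} -> 0 < h ->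
  (\int[lebesgue_measure]_(x in `]a, b[) (F (x + h) - F x)%:E <=
    ((F (b + h) - F a) * h)%:E)%E.
Proof.
move=> ab cF ndF h0.
have cincr : continuous (fun x => F (x + h) - F x).
  move=> x; apply: cvgB; last exact: cF.
  apply: continuous_comp; last exact: cF.
  by apply: cvgD; [exact: cvg_id|exact: cvg_cst].
have intF c d : lebesgue_measure.-integrable `[c, d] (EFin \o F).
  apply: continuous_compact_integrable; first exact: segment_compact.
  exact: continuous_subspaceT.
(* The left endpoint is moved away from [a] so that [Phi] has a two-sided
   derivative on the whole of the segment. *)
pose Phi x := (\int[lebesgue_measure]_(t in `[a - 1, x]) F t)%R.
have dPhi x : a - 1 < x -> is_derive x 1 Phi (F x).
  move=> ax; have [] := @continuous_FTC1_closed _ F (a - 1) x (x + 1) _ (intF _ _) ax (cF x).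
    by rewrite ltrDl.
  by move=> dP <-; rewrite derive1E; exact: derivableP.
have dPhih x : a - 1 < x -> is_derive x 1 (fun y => Phi (y + h)) (F (x + h)).
  move=> ax; have := is_derive1_comp (f := Phi) (g := fun y => y + h) (x := x).
  move=> /(_ (F (x + h)) 1); rewrite mulr1; apply; last exact: is_derive_shift.
  by apply: dPhi; lra.
have Phi_incr x : a - 1 < x -> exists2 y, x <= y <= x + h & Phi (x + h) - Phi x = F y * h.
  move=> ax; have xh : x <= x + h by rewrite lerDl ltW.
  have [||y] := @MVT_segment R Phi F x (x + h) xh.
  - by move=> y; rewrite in_itv/= => /andP[xy _]; apply: dPhi; lra.
  - apply: derivable_within_continuous => y; rewrite in_itv/= => /andP[xy _].
    by have [] := dPhi y ltac:(lra).
  by rewrite in_itv/= [_ + h]addrC addrK => yx ->; exists y; rewrite // addrC.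
pose K x := Phi (x + h) - Phi x.
have dK x : a - 1 < x -> is_derive x 1 K (F (x + h) - F x).
  by move=> ax; apply: is_deriveB; [exact: dPhih|exact: dPhi].
have cK x : a - 1 < x -> {for x, continuous K}.
  by move=> /dK [+ _]; move=> /derivable1_diffP /differentiable_continuous.
apply: (@le_trans _ _ (\int[lebesgue_measure]_(x in `[a, b]) (F (x + h) - F x)%:E)%E).
  apply: ge0_subset_integral => //.
  - have mi : measurable_fun `[a, b] (fun x => F (x + h) - F x).
      by apply: measurable_funTS; exact: continuous_measurable_fun.
    exact/measurable_EFinP.
  - by move=> x _; rewrite lee_fin subr_ge0 ndF// lerDl ltW.
  - exact: subset_itv_oo_cc.
rewrite (@continuous_FTC2 _ _ K)//.
- rewrite -EFinB lee_fin /K.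
  have [y /andP[_ yb] ->] := Phi_incr b ltac:(lra).
  have [y' /andP[y'a _] ->] := Phi_incr a ltac:(lra).
  by rewrite -mulrBl ler_wpM2r ?lerB ?ndF// ltW.
- exact: continuous_subspaceT.
- split.
  + by move=> x; rewrite in_itv/= => /andP[ax _]; have [] := dK x ltac:(lra).
  + by apply: cvg_at_right_filter; apply: cK; lra.
  + by apply: cvg_at_left_filter; apply: cK; lra.
- move=> x; rewrite in_itv/= => /andP[ax _].
  by rewrite derive1E; have [_] := dK x ltac:(lra).
Qed.

(** One half of the fundamental theorem of calculus, valid without continuity
    of the derivative: by Fatou's lemma applied to the difference quotients of
    a monotone function, whose integrals are controlled by
    [integral_increment_le]. *)
Lemma integral_derive_le (R : realType) (F u : R -> R) (a b : R) :
  a < b -> continuous F -> {homo F : x y / x <= y} ->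
  (forall x, a < x < b -> derivable F x 1) ->
  measurable_fun `]a, b[ u ->
  (forall x, a < x < b -> 0 <= u x <= 'D_1 F x) ->
  (\int[lebesgue_measure]_(x in `]a, b[) (u x)%:E <= (F b - F a)%:E)%E.
Proof.
move=> ab cF ndF dF mu u_le.
pose D n x := (F (x + harmonic n) - F x) * n.+1%:R.
have cincr (h : R) : continuous (fun x => F (x + h) - F x).
  move=> x; apply: cvgB; last exact: cF.
  apply: continuous_comp; last exact: cF.
  by apply: cvgD; [exact: cvg_id|exact: cvg_cst].
have Dge0 n x : 0 <= D n x.
  by rewrite mulr_ge0// subr_ge0 ndF// lerDl harmonic_ge0.
have cD n : continuous (D n).
  move=> x; apply: cvgMl; apply: cvgB; last exact: cF.
  apply: continuous_comp; last exact: cF.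
  by apply: cvgD; [exact: cvg_id|exact: cvg_cst].
have mD n : measurable_fun `]a, b[ (D n).
  by apply: measurable_funTS; exact: continuous_measurable_fun.
have cvD x : a < x < b -> D n x @[n --> \oo] --> 'D_1 F x.
  have -> : (fun n => D n x) =
      (fun n => (F (x + harmonic n *: 1) - F x) * n.+1%:R).
    by apply/funext => n; rewrite /D [_ *: _]mulr1.
  by move=> /dF /derive_harmonic_cvg.
have mF' : measurable_fun `]a, b[ ('D_1 F).
  apply: (measurable_fun_cvg mD) => x /=; rewrite in_itv/=; exact: cvD.
have intD n : (\int[lebesgue_measure]_(x in `]a, b[) (D n x)%:E <=
    (F (b + harmonic n) - F a)%:E)%E.
  have h0 : 0 < @harmonic R n by exact: harmonic_gt0.
  under eq_integral do rewrite EFinM.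
  rewrite ge0_integralZr//; last 2 first.
  - have mi : measurable_fun `]a, b[ (fun x => F (x + harmonic n) - F x).
      by apply: measurable_funTS; apply: continuous_measurable_fun; exact: cincr.
    exact/measurable_EFinP.
  - by move=> x _; rewrite lee_fin subr_ge0 ndF// lerDl ltW.
  rewrite -lee_pdivlMr// -EFinM mulrC.
  apply: (le_trans (integral_increment_le ab cF ndF h0)).
  by rewrite lee_fin mulrC.
have cvDE x : a < x < b -> limn_einf (fun n => (D n x)%:E) = ('D_1 F x)%:E.
  move=> /cvD xab.
  have /cvg_limn_einf_sup[-> //] : (D n x)%:E @[n --> \oo] --> ('D_1 F x)%:E.
  by apply: cvg_EFin => //; exact: nearW.
apply: (@le_trans _ _ (\int[lebesgue_measure]_(x in `]a, b[)
   limn_einf (fun n => (D n x)%:E))%E).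
  apply: (@le_trans _ _ (\int[lebesgue_measure]_(x in `]a, b[) ('D_1 F x)%:E)%E).
    apply: ge0_le_integral => //.
    - by move=> x /=; rewrite in_itv/= => /u_le/andP[]; rewrite lee_fin.
    - exact/measurable_EFinP.
    - exact/measurable_EFinP.
    - by move=> x /=; rewrite in_itv/= => /u_le/andP[_]; rewrite lee_fin.
  rewrite le_eqVlt; apply/orP; left; apply/eqP; apply: eq_integral => x.
  by rewrite inE/= in_itv/= => /cvDE.
apply: (le_trans (fatou _ _ _ _)) => //.
- by move=> n; apply/measurable_EFinP; exact: mD.
- by move=> n x _; rewrite lee_fin.
have cvb : (F (b + harmonic n) - F a)%:E @[n --> \oo] --> (F b - F a)%:E.
  apply: cvg_EFin; first exact: nearW.
  apply: cvgB; last exact: cvg_cst.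
  apply: continuous_cvg; first exact: cF.
  rewrite -[X in _ --> X](addr0 b).
  by apply: cvgD; [exact: cvg_cst|exact: cvg_harmonic].
rewrite limn_einf_lim -(cvg_lim _ cvb)//.
apply: lee_lim; [exact: is_cvg_einfs|by apply/cvg_ex; eexists; exact: cvb|].
apply: nearW => n; apply: le_trans (intD n).
by apply: ereal_inf_lbound; exists n => /=.
Qed.

(** The drift estimate of the whole proof: [s |-> - (q s * expR (- s))] has
    derivative [(q s - 'D_1 q s) * expR (- s)], starts at [- q 0] and stays
    nonpositive. *)
Lemma exponential_average_le (R : realType) (q u : R -> R) :
  (forall s, 0 <= s -> 0 <= q s) ->
  (forall s, 0 <= s -> derivable q s 1) ->
  measurable_fun [set: R] u ->
  (forall s, 0 < s -> 0 <= u s <= q s - 'D_1 q s) ->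
  (\int[lebesgue_measure]_(s in `]0%R, +oo[) (u s * expR (- s))%:E
    <= (q 0)%:E)%E.
Proof.
move=> q0 dq mu u_le.
pose g x := - (q x * expR (- x)).
have dg (x : R) : 0 <= x -> is_derive x 1 g ((q x - 'D_1 q x) * expR (- x)).
  move=> x0.
  have dE : is_derive x 1 (fun x : R => expR (- x)) (- expR (- x)).
    have := is_derive1_comp (f := expR) (g := -%R) (x := x).
    by move=> /(_ _ _ _ (is_deriveNid _ _)); rewrite mulrN1; apply.
  have dqx := derivableP (dq x x0).
  have [] := is_deriveN (is_deriveM dqx dE).
  move=> dg1 dg2; apply: DeriveDef; first exact: dg1.
  rewrite [LHS]dg2.
  by rewrite /GRing.scale/=; ring.
(* Nothing is known about [q] at negative times: [G] freezes it there, which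
   makes [G] continuous and monotone on the whole line. *)
pose G x := g (Num.max x 0).
have cg (x : R) : 0 <= x -> {for x, continuous g}.
  by move=> /dg[+ _]; move=> /derivable1_diffP /differentiable_continuous.
have cG : continuous G.
  move=> x.
  have cmax : {for x, continuous (fun y : R => Num.max y 0)}.
    have := @continuous_max R R id (cst (0 : R)) x.
    by apply; [exact: cvg_id|exact: cvg_cst].
  apply: (continuous_comp cmax (g := g)).
  by apply: cg; rewrite le_max lexx orbT.
have dG (x : R) : 0 < x -> is_derive x 1 G ((q x - 'D_1 q x) * expR (- x)).
  move=> x0; apply: near_eq_is_derive (dg x (ltW x0)).
  near=> y; rewrite /G max_l// ltW//.
  by near: y; exact: lt_nbhsr.
have ndG : {homo G : x y / x <= y}.
  move=> x y xy; rewrite /G.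
  apply: (@ger0_derive1_ndecry R g 0).
  - by move=> z; rewrite in_itv/= andbT => z0; have [] := dg z (ltW z0).
  - move=> z; rewrite in_itv/= andbT => z0; rewrite derive1E.
    have [_ ->] := dg z (ltW z0).
    by have /andP[u0 uq] := u_le z z0; rewrite mulr_ge0 ?expR_ge0// (le_trans u0).
  - apply: derivable_within_continuous => z; rewrite in_itv/= andbT => z0.
    by have [] := dg z z0.
  - by rewrite le_max lexx orbT.
  - by rewrite ge_max !le_max xy lexx !orbT.
have mue (D : set R) : measurable_fun D (fun s => u s * expR (- s)).
  apply: measurable_funTS; apply: measurable_funM => //.
  by apply: measurableT_comp => //; exact: measurable_funN.
pose I n := (`]0, (0 + (n + 1)%:R)[ : set R)%classic.
have bndI n : (\int[lebesgue_measure]_(s in I n) (u s * expR (- s))%:E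
    <= (q 0)%:E)%E.
  have n0 : 0 < 0 + (n + 1)%:R :> R by rewrite add0r ltr0n addn1.
  apply: (le_trans (integral_derive_le n0 cG ndG _ _ _)) => //.
  - by move=> x /andP[x0 _]; have [] := dG x x0.
  - move=> x /andP[x0 _]; have [_ ->] := dG x x0.
    have /andP[u0 uq] := u_le x x0.
    by rewrite mulr_ge0 ?expR_ge0// ler_wpM2r ?expR_ge0.
  - rewrite lee_fin /G maxxx max_l ?(ltW n0)// /g oppr0 expR0 mulr1.
    by rewrite opprK gerDr oppr_le0 mulr_ge0 ?expR_ge0// q0// ltW.
rewrite (itv_bndy_bigcup_BLeft_shift false 0 1).
apply: (cvge_le _ (ge0_nondecreasing_set_cvg_integral _ _ _ _)).
- exact: nearW.
- move=> m n mn; apply/subsetPset; apply: subset_itvl.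
  by rewrite bnd_simp lerD2l ler_nat leq_add2r.
- by move=> n; exact: measurable_itv.
- by move=> n; apply/measurable_EFinP; exact: mue.
- move=> n x /=; rewrite in_itv/= => /andP[x0 _].
  by rewrite lee_fin mulr_ge0 ?expR_ge0//; case/andP: (u_le x x0).
Unshelve. all: by end_near. Qed.

End ExponentialAverage.

(** * Independent pairs and iterated random maps *)

Section IndependentPair.
Local Set Implicit Arguments.
Local Unset Strict Implicit.
Local Open Scope ereal_scope.

(** The density agrees almost everywhere with the Radon-Nikodym derivative, for
    which the change of variables is known. *)
Lemma ge0_integral_density d (T : measurableType d) (R : realType)
    (nu : {finite_measure set T -> \bar R})
    (mu : {sigma_finite_measure set T -> \bar R}) (g f : T -> \bar R) :
  mu.-integrable [set: T] g ->
  (forall A, measurable A -> nu A = \int[mu]_(x in A) g x) ->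
  (forall x, 0 <= f x) -> measurable_fun [set: T] f ->
  \int[nu]_x f x = \int[mu]_x (f x * g x).
Proof.
move=> ig nuE f0 mf.
have numu : nu `<< mu.
  apply/null_content_dominatesP => A mA muA0.
  rewrite nuE// null_set_integral//; apply/measurable_funTS.
  exact: measurable_int ig.
rewrite -(Radon_Nikodym_SigmaFinite.change_of_variables numu f0)//.
have iRN := Radon_Nikodym_SigmaFinite.f_integrable numu.
have mRN := measurable_int _ iRN.
have mg := measurable_int _ ig.
apply: ae_eq_integral => //.
- exact: emeasurable_funM.
- exact: emeasurable_funM.
- apply: ae_eqe_mul2l; apply: integral_ae_eq => // A _ mA.
  by rewrite -Radon_Nikodym_SigmaFinite.f_integral// nuE.
Qed.

Lemma ge0_integral_exponential_law d (Omega : measurableType d) (R : realType)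
    (P : probability Omega R) (S : {RV P >-> R}) (u : R -> R) :
  (forall A : set R, measurable A -> P (S @^-1` A) = exponential_prob 1 A) ->
  (forall s, 0 <= u s)%R -> measurable_fun [set: R] u ->
  \int[P]_om (u (S om))%:E =
  \int[lebesgue_measure]_(s in `]0%R, +oo[) (u s * expR (- s))%:E.
Proof.
move=> expS u0 mu.
(* Lebesgue measure lives on [measurableTypeR R], which has the Borel sets of
   [R] under another display; [S] is repackaged accordingly. *)
have mS : measurable_fun [set: Omega] (S : Omega -> measurableTypeR R).
  exact: (measurable_funP S).
pose SR : {mfun Omega >-> measurableTypeR R} :=
  HB.pack (S : Omega -> measurableTypeR R) (isMeasurableFun.Build _ _ _ _ _ mS).
have mEu : measurable_fun [set: measurableTypeR R] (EFin \o u).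
  exact/measurable_EFinP.
rewrite -[LHS](ge0_integral_distribution SR mEu)//.
rewrite (ge0_integral_density (integrable_exponential_pdf ltr01))//.
have mE : measurable_fun [set: R] (fun s => u s * expR (- s))%R.
  apply: measurable_funM => //.
  by apply: measurableT_comp => //; exact: measurable_funN.
rewrite integral_itv_obnd_cbnd; last exact/measurable_EFinP/measurable_funTS.
rewrite [RHS]integral_mkcond; apply: eq_integral => s _.
rewrite patchE/= -EFinM /exponential_pdf patchE.
by case: ifPn => _; rewrite ?mulr0// mulN1r mul1r.
Qed.

(** Independence says that the law of the pair is the product of the laws, and
    Tonelli's theorem applies. *)
Lemma ge0_integral_indep_pair d d1 d2 (Omega : measurableType d)
    (E1 : measurableType d1) (E2 : measurableType d2) (R : realType)
    (P : probability Omega R) (X : {RV P >-> E1}) (Y : {RV P >-> E2})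
    (psi : E1 * E2 -> \bar R) :
  (forall A B, measurable A -> measurable B ->
    P (X @^-1` A `&` Y @^-1` B) = P (X @^-1` A) * P (Y @^-1` B)) ->
  (forall xy, 0 <= psi xy) -> measurable_fun [set: E1 * E2] psi ->
  \int[P]_om psi (X om, Y om) =
  \int[P]_om \int[P]_om' psi (X om, Y om').
Proof.
move=> indep psi0 mpsi.
have mXY : measurable_fun [set: Omega] (fun om => (X om, Y om)).
  exact: measurable_fun_pair.
pose XY : {mfun Omega >-> (E1 * E2)%type} :=
  HB.pack (fun om => (X om, Y om)) (isMeasurableFun.Build _ _ _ _ _ mXY).
rewrite -[LHS](ge0_integral_distribution (XY : {RV P >-> (E1 * E2)%type}) mpsi psi0).
have lawE A : measurable A ->
    distribution P XY A = (distribution P X \x distribution P Y) A.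
  by move=> mA; apply/esym; apply: product_measure_unique => //.
rewrite (eq_measure_integral _ (fun A mA _ => lawE A mA)).
rewrite fubini_tonelli1// ge0_integral_distribution//.
- apply: eq_integral => om _ /=; rewrite /fubini_F ge0_integral_distribution//.
  exact: measurableT_comp.
- exact: measurable_fun_fubini_tonelli_F.
- by move=> x; apply: integral_ge0.
Qed.
(** Rectangles generate the product sigma-algebra and are stable under
    intersection, so independence from [D] of the events that [X] and [Y]
    generate by rectangles extends to all the events that the pair generates. *)
Lemma indep_future_step d dE (Omega : measurableType d) (E : measurableType dE)
    (R : realType) (P : probability Omega R) (X : {RV P >-> E})
    (Y : {RV P >-> R}) (D : set Omega) :
  measurable D ->
  (forall A B, measurable A -> measurable B ->
    P (X @^-1` A `&` Y @^-1` B `&` D) = P (X @^-1` A `&` Y @^-1` B) * P D) ->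
  forall C : set (E * R), measurable C ->
    P ((fun om => (X om, Y om)) @^-1` C `&` D) =
    P ((fun om => (X om, Y om)) @^-1` C) * P D.
Proof.
move=> mD indep C mC.
have mXY : measurable_fun [set: Omega] (fun om => (X om, Y om)).
  exact: measurable_fun_pair.
pose XY : {mfun Omega >-> (E * R)%type} :=
  HB.pack (fun om => (X om, Y om)) (isMeasurableFun.Build _ _ _ _ _ mXY).
pose r : {nonneg R} := NngNum (fine_ge0 (measure_ge0 P D)).
have rE : r%:num%:E = P D by rewrite /= fineK// fin_num_measure.
pose m1 := pushforward (mrestr P mD) XY.
pose m2 := mscale r (distribution P XY).
suff : m1 C = m2 C.
  rewrite /m1 /m2 /pushforward/= /mscale/= rE muleC.
  by [].
pose G : set (set (E * R)) :=
  [set C | exists A, measurable A /\ exists B, measurable B /\ C = A `*` B].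
apply: (measure_unique G (fun=> setT)) => //.
- rewrite measurable_prod_measurableType //; congr (<<s _ >>).
  rewrite predeqE; split => [[A mA [B mB <-]]|[A [mA [B [mB ->]]]]].
    by exists A; split => //; exists B.
  by exists A => //; exists B.
- move=> _ _ [A1 [mA1 [B1 [mB1 ->]]]] [A2 [mA2 [B2 [mB2 ->]]]].
  rewrite -setXI; exists (A1 `&` A2); split; first exact: measurableI.
  by exists (B1 `&` B2); split => //; exact: measurableI.
- by move=> _; exists setT; split => //; exists setT; split => //; rewrite setXTT.
- by rewrite bigcup_const.
- move=> _ [A [mA [B [mB ->]]]].
  rewrite /m1 /m2 /pushforward/= /mscale/= rE muleC.
  exact: indep.
- move=> _; rewrite /= /pushforward/= /mrestr setTI.
  exact: le_lt_trans (probability_le1 _ mD) (ltry _).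
Qed.

Lemma measurable_iterated d dE (Omega : measurableType d)
    (E : measurableType dE) (R : realType) (F : E * R -> E) (x0 : E)
    (S : nat -> Omega -> R) (X : nat -> Omega -> E) :
  measurable_fun [set: E * R] F ->
  (forall k, measurable_fun [set: Omega] (S k)) ->
  (forall om, X 0%N om = x0) ->
  (forall k om, X k.+1 om = F (X k om, S k om)) ->
  forall k, measurable_fun [set: Omega] (X k).
Proof.
move=> mF mS X0 XS; elim=> [|k IH].
  by rewrite (_ : X 0%N = cst x0); [exact: measurable_cst|exact/funext].
rewrite (_ : X k.+1 = F \o (fun om => (X k om, S k om))); last exact/funext.
by apply: measurableT_comp => //; exact: measurable_fun_pair.
Qed.

(** The present of an iterated random map is independent of the noise to come.
    The statement quantifies over finite sets [s] of later indices because the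
    induction step moves the index [k] from the noise into the state. *)
Lemma indep_iterated d dE (Omega : measurableType d)
    (E : measurableType dE) (R : realType) (P : probability Omega R)
    (F : E * R -> E) (x0 : E)
    (S : nat -> Omega -> R) (X : nat -> Omega -> E) :
  measurable_fun [set: E * R] F ->
  (forall k, measurable_fun [set: Omega] (S k)) ->
  independent_RVs P S ->
  (forall om, X 0%N om = x0) ->
  (forall k om, X k.+1 om = F (X k om, S k om)) ->
  forall k (s : seq nat) (A : set E) (B : nat -> set R),
    uniq s -> {in s, forall i, (k <= i)%N} ->
    measurable A -> (forall i, measurable (B i)) ->
    P (X k @^-1` A `&` \bigcap_(i in [set` s]) (S i @^-1` B i)) =
    P (X k @^-1` A) * \prod_(i <- s) P (S i @^-1` B i).
Proof.
move=> mF mS indS X0 XS.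
have mX := measurable_iterated mF mS X0 XS.
have preimage_measurable d' (T : measurableType d') (g : Omega -> T) (A : set T) :
    measurable_fun setT g -> measurable A -> measurable (g @^-1` A).
  by move=> mg mA; rewrite -[X in measurable X]setTI; exact: mg.
elim=> [|k IH] s A B us ks mA mB.
  rewrite (_ : X 0%N @^-1` A = if `[< A x0 >] then setT else set0); last first.
    apply/seteqP; split => om /=; rewrite X0; case: asboolP => //.
  case: asboolP => _; last by rewrite set0I measure0 mul0e.
  by rewrite setTI probability_setT mul1e; exact: indS.
have ksn : k \notin s by apply/negP => /ks; rewrite ltnn.
set D := \bigcap_(i in _) _.
have mD : measurable D.
  by apply: fin_bigcap_measurable => // i _; exact: preimage_measurable.
have PD : P D = \prod_(i <- s) P (S i @^-1` B i) by exact: indS.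
pose XR : {RV P >-> E} := HB.pack (X k) (isMeasurableFun.Build _ _ _ _ _ (mX k)).
pose SR : {RV P >-> R} := HB.pack (S k) (isMeasurableFun.Build _ _ _ _ _ (mS k)).
rewrite -PD.
have := @indep_future_step _ _ _ _ _ P XR SR D mD _ (F @^-1` A).
rewrite (_ : X k.+1 @^-1` A = (fun om => (X k om, S k om)) @^-1` (F @^-1` A)).
  apply.
    move=> A' B' mA' mB' /=.
    pose B'' i := if i == k then B' else B i.
    have mB'' i : measurable (B'' i) by rewrite /B''; case: ifP.
    have B''s i : i \in s -> B'' i = B i.
      by rewrite /B''; case: eqP => // -> ; rewrite (negbTE ksn).
    have capE : \bigcap_(i in [set` k :: s]) (S i @^-1` B'' i) = S k @^-1` B' `&` D.
      apply/seteqP; split => om /=.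
        move=> h; split; first by have := h k (mem_head _ _); rewrite /B'' eqxx.
        move=> i /= si; have := h i; rewrite /= inE si orbT => /(_ isT).
        by rewrite B''s.
      move=> [hk hD] i /=; rewrite inE => /predU1P[->|si].
        by rewrite /B'' eqxx.
      by rewrite B''s//; exact: hD.
    rewrite -setIA -capE IH//=; last 2 first.
    - by rewrite ksn.
    - by move=> i; rewrite inE => /predU1P[->//|/ks/ltnW].
    rewrite big_cons {1}/B'' eqxx.
    have -> : X k @^-1` A' `&` S k @^-1` B' =
        X k @^-1` A' `&` \bigcap_(i in [set` [:: k]]) (S i @^-1` (fun=> B') i).
      by congr (_ `&` _); rewrite set_cons1 bigcap_set1.
    rewrite IH//; last by move=> i; rewrite inE => /eqP->.
    rewrite big_seq1 -muleA PD; congr (_ * (_ * _)).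
    by apply: eq_big_seq => i si; rewrite B''s.
  rewrite -[X in measurable X]setTI; exact: mF.
by apply/funext => om /=; rewrite XS.
Qed.
(** A bound on the mean over the next waiting time only, the state being held
    fixed, becomes a bound between expectations, because the state is
    independent of that waiting time. *)
Lemma iterated_drift_le d dE (Omega : measurableType d)
    (E : measurableType dE) (R : realType) (P : probability Omega R)
    (F : E * R -> E) (x0 : E)
    (S : nat -> Omega -> R) (X : nat -> Omega -> E) (V V' : E -> R) (k : nat) :
  measurable_fun [set: E * R] F ->
  (forall k, measurable_fun [set: Omega] (S k)) ->
  independent_RVs P S ->
  (forall k (A : set R), measurable A -> P (S k @^-1` A) = exponential_prob 1 A) ->
  (forall om, X 0%N om = x0) ->
  (forall k om, X k.+1 om = F (X k om, S k om)) ->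
  measurable_fun [set: E] V -> measurable_fun [set: E] V' ->
  (forall x, 0 <= V' x)%R ->
  (forall om, \int[lebesgue_measure]_(s in `]0%R, +oo[)
     (V' (F (X k om, s)) * expR (- s))%:E <= (V (X k om))%:E) ->
  \int[P]_om (V' (X k.+1 om))%:E <= \int[P]_om (V (X k om))%:E.
Proof.
move=> mF mS indS expS X0 XS mV mV' V'0 drift.
have mX := measurable_iterated mF mS X0 XS.
pose XR : {RV P >-> E} := HB.pack (X k) (isMeasurableFun.Build _ _ _ _ _ (mX k)).
pose SR : {RV P >-> R} := HB.pack (S k) (isMeasurableFun.Build _ _ _ _ _ (mS k)).
pose psi xs := (V' (F xs))%:E.
have psi0 xs : 0 <= psi xs by rewrite lee_fin.
have mVF : measurable_fun [set: E * R] (V' \o F) by exact: measurableT_comp.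
have mpsi : measurable_fun [set: E * R] psi by exact/measurable_EFinP.
under eq_integral do rewrite XS.
have indXS (A : set E) (B : set R) : measurable A -> measurable B ->
    P (XR @^-1` A `&` SR @^-1` B) = P (XR @^-1` A) * P (SR @^-1` B).
  move=> mA mB.
  have := @indep_iterated _ _ _ _ _ _ _ _ _ _ mF mS indS X0 XS k [:: k] A
    (fun=> B) isT _ mA (fun=> mB).
  rewrite big_seq1 set_cons1 bigcap_set1; apply.
  by move=> i; rewrite inE => /eqP->.
rewrite [leLHS](ge0_integral_indep_pair indXS psi0 mpsi).
apply: ge0_le_integral => //.
- by move=> om _; exact: integral_ge0.
- rewrite (_ : (fun om => _) =
      fubini_F (distribution P SR) psi \o XR); last first.
    apply/funext => om /=; rewrite /fubini_F ge0_integral_distribution//.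
    exact: measurableT_comp.
  by apply: measurableT_comp => //; exact: measurable_fun_fubini_tonelli_F.
- by apply/measurable_EFinP; exact: measurableT_comp.
- move=> om _; apply: le_trans (drift om).
  rewrite (ge0_integral_exponential_law (S := SR) (u := fun s => V' (F (X k om, s))))//.
    exact: expS.
  by apply: (measurableT_comp mVF); exact: measurable_pair1.
Qed.
End IndependentPair.

(** * Measurability in coordinates *)

Section CoordinateMeasurability.
Local Set Implicit Arguments.
Local Unset Strict Implicit.

Definition coord_measurable d (T : measurableType d) (R : realType) (n : nat)
    (g : T -> 'rV[R]_n) : Prop :=
  forall i, measurable_fun [set: T] (fun x => g x 0 i).

(** A function of the integer parts of the coordinates takes countably many
    values, each on a countable union of boxes. *)
Lemma measurable_discretized d (T : measurableType d) (R : realType)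
    (n : nat) (c : R) (g : T -> 'rV[R]_n) (h : ('I_n -> int) -> R) :
  0 < c -> coord_measurable g ->
  measurable_fun [set: T] (fun x => h (fun i => Num.floor (g x 0 i * c))).
Proof.
move=> c0 mg _ B mB; rewrite setTI.
pose cell (z : {ffun 'I_n -> int}) :=
  \bigcap_(i : 'I_n) [set x | (z i)%:~R <= g x 0 i * c < (z i + 1)%:~R].
have mcell z : measurable (cell z).
  apply: fin_bigcap_measurable => // i _.
  rewrite -[X in measurable X]setTI.
  have -> : [set x | (z i)%:~R <= g x 0 i * c < (z i + 1)%:~R] =
      (fun x => g x 0 i * c) @^-1` `[(z i)%:~R, (z i + 1)%:~R[%classic.
    by apply/seteqP; split => x /=; rewrite in_itv.
  have mgc : measurable_fun [set: T] (fun x => g x 0 i * c).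
    by apply: measurable_funM => //; exact: mg.
  by apply: mgc => //; exact: measurable_itv.
rewrite (_ : _ @^-1` B = \bigcup_(z : {ffun 'I_n -> int})
    (if `[< B (h z) >] then cell z else set0)).
  by apply: countable_bigcupT_measurable => // z; case: ifP.
apply/seteqP; split => x /=.
  move=> Bx; exists [ffun i => Num.floor (g x 0 i * c)] => //.
  rewrite (_ : ([ffun i => _] : _ -> _) = fun i => Num.floor (g x 0 i * c)); last first.
    by apply/funext => i; rewrite ffunE.
  by rewrite asboolT// => i _ /=; rewrite ffunE; exact: floor_itv.
move=> [z _]; case: asboolP => // Bz xz.
rewrite (_ : (fun i => _) = z)//; apply/funext => i.
by apply: floor_def; exact: xz.
Qed.

Definition discretize (R : realType) (n : nat) (m : nat) (z : 'I_n -> int) :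
    'rV[R]_n := \row_i ((z i)%:~R * harmonic m).
Arguments discretize {R n}.

(** Rounding down on the grid of mesh [harmonic m] moves every coordinate by
    less than the mesh. *)
Lemma cvg_discretize (R : realType) (n : nat) (y : 'rV[R]_n) :
  discretize m (fun i => Num.floor (y 0 i * m.+1%:R)) @[m --> \oo] --> y.
Proof.
apply/cvg_ballP => e e0.
have := @cvg_harmonic R => /cvgrPdist_lt/(_ _ e0) h.
near=> m.
have me : harmonic m < e.
  have : `|0 - harmonic m| < e by near: m.
  by rewrite sub0r normrN ger0_norm ?harmonic_ge0.
have m0 : 0 < m.+1%:R :> R by rewrite ltr0n.
split => // i j; rewrite (ord1 i) mxE.
have /andP[fl fr] := floor_itv (y 0 j * m.+1%:R).
set z := Num.floor _ in fl fr *.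
rewrite /ball/= ltr_norml; apply/andP; split.
  rewrite (lt_le_trans (y := 0)) ?oppr_lt0//.
  by rewrite subr_ge0 ler_pdivrMr.
apply: le_lt_trans me; rewrite lerBlDr -[X in X + _]mul1r -mulrDl.
by rewrite ler_pdivlMr// ltW//; move: fr; rewrite intrD addrC.
Unshelve. all: by end_near. Qed.

(** A continuous function is the pointwise limit of its values at the grid
    points. *)
Lemma measurable_continuous_coord d (T : measurableType d) (R : realType)
    (n : nat) (f : 'rV[R]_n -> R) (g : T -> 'rV[R]_n) :
  continuous f -> coord_measurable g ->
  measurable_fun [set: T] (fun x => f (g x)).
Proof.
move=> cf mg.
apply: (measurable_fun_cvg (h := fun m x =>
  f (discretize m (fun i => Num.floor (g x 0 i * m.+1%:R))))).
  by move=> m; exact: (measurable_discretized (f \o discretize m)).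
move=> x _; apply: continuous_cvg; first exact: cf.
exact: cvg_discretize.
Qed.

Lemma coord_measurableD d (T : measurableType d) (R : realType) (n : nat)
    (g h : T -> 'rV[R]_n) :
  coord_measurable g -> coord_measurable h ->
  coord_measurable (fun x => g x + h x).
Proof.
move=> mg mh i; under eq_fun do rewrite mxE.
by apply: measurable_funD; [exact: mg|exact: mh].
Qed.

Lemma coord_measurableZ d (T : measurableType d) (R : realType) (n : nat)
    (a : T -> R) (g : T -> 'rV[R]_n) :
  measurable_fun [set: T] a -> coord_measurable g ->
  coord_measurable (fun x => a x *: g x).
Proof.
move=> ma mg i; under eq_fun do rewrite mxE.
by apply: measurable_funM => //; exact: mg.
Qed.

Lemma coord_measurableB d (T : measurableType d) (R : realType) (n : nat)
    (g h : T -> 'rV[R]_n) :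
  coord_measurable g -> coord_measurable h ->
  coord_measurable (fun x => g x - h x).
Proof.
move=> mg mh i; under eq_fun do rewrite !mxE.
by apply: measurable_funB; [exact: mg|exact: mh].
Qed.

Lemma coord_measurable_cst d (T : measurableType d) (R : realType) (n : nat)
    (v : 'rV[R]_n) : coord_measurable (fun _ : T => v).
Proof. by move=> i; exact: measurable_cst. Qed.

(** Partial derivatives are limits of difference quotients along [harmonic], so
    the gradient is measurable even where it is not continuous. *)
Lemma coord_measurable_grad d (T : measurableType d) (R : realType) (n : nat)
    (f : 'rV[R]_n -> R) (g : T -> 'rV[R]_n) :
  (forall x, differentiable f x) -> coord_measurable g ->
  coord_measurable (fun x => grad f (g x)).
Proof.
move=> df mg i; under eq_fun do rewrite mxE.
have cf : continuous f by move=> x; exact: differentiable_continuous.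
apply: (measurable_fun_cvg (h := fun m x =>
  (f (g x + harmonic m *: delta_mx 0 i) - f (g x)) * m.+1%:R)); last first.
  by move=> x _; apply: derive_harmonic_cvg; exact: diff_derivable.
move=> m; apply: measurable_funM => //; apply: measurable_funB.
  by apply: measurable_continuous_coord => //; exact: coord_measurableD.
exact: measurable_continuous_coord.
Qed.

Lemma measurable_dotv d (T : measurableType d) (R : realType) (n : nat)
    (g h : T -> 'rV[R]_n) :
  coord_measurable g -> coord_measurable h ->
  measurable_fun [set: T] (fun x => dotv (g x) (h x)).
Proof.
move=> mg mh; rewrite /dotv; apply: measurable_sum => i.
by apply: measurable_funM; [exact: mg|exact: mh].
Qed.

End CoordinateMeasurability.

(** * The energy and its change at an arrival *)

Section LyapunovStep.
Local Set Implicit Arguments.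
Local Unset Strict Implicit.

Lemma dotvBl (R : realType) (n : nat) (x y u : 'rV[R]_n) :
  dotv (x - y) u = dotv x u - dotv y u.
Proof.
by rewrite /dotv -sumrB; apply: eq_bigr => i _; rewrite !mxE mulrBl.
Qed.

Lemma dotvC (R : realType) (n : nat) (x y : 'rV[R]_n) : dotv x y = dotv y x.
Proof. by apply: eq_bigr => i _; rewrite mulrC. Qed.

Lemma dotvBr (R : realType) (n : nat) (x y u : 'rV[R]_n) :
  dotv u (x - y) = dotv u x - dotv u y.
Proof. by rewrite dotvC dotvBl !(dotvC u). Qed.

Lemma dotvZr (R : realType) (n : nat) (a : R) (x u : 'rV[R]_n) :
  dotv u (a *: x) = a * dotv u x.
Proof.
by rewrite /dotv mulr_sumr; apply: eq_bigr => i _; rewrite !mxE mulrCA.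
Qed.

Lemma dotvZl (R : realType) (n : nat) (a : R) (x u : 'rV[R]_n) :
  dotv (a *: x) u = a * dotv x u.
Proof. by rewrite dotvC dotvZr dotvC. Qed.

Lemma dotvv_ge0 (R : realType) (n : nat) (x : 'rV[R]_n) : 0 <= dotv x x.
Proof. by apply: sumr_ge0 => i _; rewrite -expr2 sqr_ge0. Qed.

Lemma enorm_sqr (R : realType) (n : nat) (x : 'rV[R]_n) :
  enorm x ^+ 2 = dotv x x.
Proof. by rewrite sqr_sqrtr// dotvv_ge0. Qed.

Lemma derive_grad (R : realType) (n : nat) (f : 'rV[R]_n -> R)
    (x d : 'rV[R]_n) :
  differentiable f x -> 'D_d f x = dotv (grad f x) d.
Proof.
move=> df; rewrite deriveE// {1}(row_sum_delta d) linear_sum.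
apply: eq_bigr => i _; rewrite linearZ mxE deriveE//= mulrC.
by [].
Qed.

Lemma is_derive_line (R : realType) (n : nat) (f : 'rV[R]_n -> R)
    (w d : 'rV[R]_n) (r : R) :
  differentiable f (w + r *: d) ->
  is_derive r 1 (fun r : R => f (w + r *: d)) (dotv (grad f (w + r *: d)) d).
Proof.
move=> df; have der := diff_derivable (v := d) df.
have E : (fun h : R => h^-1 *: (((fun r : R => f (w + r *: d)) \o shift r) (h *: (1 : R))
      - f (w + r *: d))) =
    (fun h : R => h^-1 *: ((f \o shift (w + r *: d)) (h *: d) - f (w + r *: d))).
  apply/funext => h /=; congr (_ *: (f _ - _)).
  by rewrite [h *: 1]mulr1 scalerDl addrCA.
apply: DeriveDef.
  by rewrite /derivable E.
by rewrite -derive_grad// /derive E.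
Qed.

(** At [T = 0] the function is constant, since [0 `^ p = 0]; with [0^-1 = 0] the
    formula for the derivative remains correct there, even at [s = 0]. *)
Lemma is_derive_mixing (R : realType) (p T s : R) : p != 0 -> 0 <= T -> 0 <= s ->
  is_derive s 1 (fun s : R => 1 - (T / (T + s)) `^ p)
    (p / (T + s) * (T / (T + s)) `^ p).
Proof.
move=> p0; rewrite le_eqVlt => /predU1P[<- s0|T0 s0].
  rewrite mul0r powR0// mulr0.
  rewrite (_ : (fun _ => _) = cst 1)//.
    exact: is_derive_cst.
  by apply/funext => t /=; rewrite mul0r powR0// subr0.
have Ts : 0 < T + s by rewrite ltr_wpDr.
have x0 : 0 < T / (T + s) by rewrite divr_gt0.
have dV : is_derive s 1 (fun s : R => T / (T + s)) (T * - (T + s) ^- 2).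
  have dD : is_derive s 1 (fun s : R => T + s) 1.
    have := is_deriveD (is_derive_cst T s 1) (is_derive_id s (1 : R)).
    by rewrite add0r.
  have := is_deriveZ T (is_deriveV (lt0r_neq0 Ts) dD).
  by rewrite [X in T *: X]mulr1.
have := is_deriveB (is_derive_cst (1 : R) s 1)
  (is_derive1_comp (f := fun y : R => y `^ p) (g := fun s => T / (T + s))
    (is_derive1_powR p x0) dV).
move=> [d1 d2]; apply: DeriveDef; first exact: d1.
rewrite [LHS]d2 sub0r powRB; last by rewrite (gt_eqF x0) implybT.
rewrite powRr1; last exact: ltW.
by field; rewrite !gt_eqF.
Qed.

Definition lyapunov (R : realType) (n : nat) (f : 'rV[R]_n -> R)
    (ws : 'rV[R]_n) (L rho t : R) (w z : 'rV[R]_n) : R :=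
  t ^+ 2 * (f w - f ws) + 2 * L / rho ^+ 2 * dotv (z - ws) (z - ws).

Lemma lyapunov_ge0 (R : realType) (n : nat) (f : 'rV[R]_n -> R)
    (ws : 'rV[R]_n) (L rho t : R) (w z : 'rV[R]_n) :
  global_minimizer f ws -> 0 < L -> 0 <= lyapunov f ws L rho t w z.
Proof.
move=> fmin L0; apply: addr_ge0; apply: mulr_ge0.
- exact: sqr_ge0.
- by rewrite subr_ge0; exact: fmin.
- by rewrite divr_ge0 ?sqr_ge0// mulr_ge0// ltW.
- exact: dotvv_ge0.
Qed.

(** The position at time [t] on the curve that starts from [w] at time [T] and
    is attracted by [z]. *)
Definition mixed (R : realType) (n : nat) (rho T t : R) (w z : 'rV[R]_n) :
    'rV[R]_n := w + (1 - (T / t) `^ (2 / rho)) *: (z - w).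

(** The velocity of the curve is [2 / (rho * (T + s)) *: (z - mixed)], and the
    factor [(T + s) ^+ 2] absorbs its denominator. *)
Lemma is_derive_sqr_gap (R : realType) (n : nat) (f : 'rV[R]_n -> R)
    (ws : 'rV[R]_n) (rho T s C : R) (w z : 'rV[R]_n) :
  (forall x, differentiable f x) -> 0 < rho -> 0 <= T -> 0 <= s ->
  is_derive s 1
    (fun s : R => (T + s) ^+ 2 * (f (mixed rho T (T + s) w z) - f ws) + C)
    (2 * (T + s) * (f (mixed rho T (T + s) w z) - f ws) +
     2 / rho * (T + s) * dotv (grad f (mixed rho T (T + s) w z))
       (z - mixed rho T (T + s) w z)).
Proof.
move=> df rho0 T0 s0.
have p0 : 2 / rho != 0 by rewrite gt_eqF// divr_gt0.
pose phi (s : R) := 1 - (T / (T + s)) `^ (2 / rho).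
have dphi : is_derive s 1 phi _ := is_derive_mixing p0 T0 s0.
have dD : is_derive s 1 (fun s : R => T + s) 1.
  have := is_deriveD (is_derive_cst T s 1) (is_derive_id s (1 : R)).
  by rewrite add0r.
have dl := is_derive_line (df (w + phi s *: (z - w))).
have dfm := is_derive1_comp (f := fun r : R => f (w + r *: (z - w))) dl dphi.
have := is_deriveD (is_deriveM (is_deriveX 2 dD)
  (is_deriveB dfm (is_derive_cst (f ws) s 1))) (is_derive_cst C s 1).
move=> [d1 d2]; apply: DeriveDef; first exact: d1.
have zm : z - mixed rho T (T + s) w z = (T / (T + s)) `^ (2 / rho) *: (z - w).
  by apply/rowP => i; rewrite !mxE; ring.
rewrite [LHS]d2 zm dotvZr /GRing.scale/= !fctE /= -/(mixed rho T (T + s) w z).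
set G := dotv _ _; set X := _ `^ _; set A := f _.
have [->|Ts] := eqVneq (T + s) 0; first by rewrite expr1; ring.
by field; rewrite Ts gt_eqF.
Qed.

(** The last line is the derivative computed in [is_derive_sqr_gap].  The step
    [rho * t / (2 * L)] of [z] is the one for which the square of the gradient
    that it creates, [t ^+ 2 / (2 * L) * dotv g g], is exactly what the step
    of [w] gains by smoothness; quasar convexity, with weight [2 * t], handles
    the remaining linear terms. *)
Lemma lyapunov_step_le (R : realType) (n : nat) (f : 'rV[R]_n -> R)
    (ws : 'rV[R]_n) (L rho t : R) (v z : 'rV[R]_n) :
  0 < L -> smooth L f -> 0 < rho -> quasar_convex rho f ws -> 0 < t ->
  lyapunov f ws L rho t (v - (1 / L) *: grad f v)
      (z - (rho * t / (2 * L)) *: grad f v) <=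
  t ^+ 2 * (f v - f ws) + 2 * L / rho ^+ 2 * dotv (z - ws) (z - ws) -
  (2 * t * (f v - f ws) + 2 / rho * t * dotv (grad f v) (z - v)).
Proof.
move=> L0 fL rho0 fq t0; rewrite /lyapunov.
set g := grad f v.
have := fL (v - (1 / L) *: g) v; rewrite -/g.
have -> : v - (1 / L) *: g - v = - (1 / L) *: g by rewrite addrC addKr scaleNr.
rewrite enorm_sqr !(dotvZr, dotvZl).
have := fq v; rewrite -/g.
have -> : z - (rho * t / (2 * L)) *: g - ws = (z - ws) - (rho * t / (2 * L)) *: g.
  by rewrite addrAC.
rewrite !(dotvBr, dotvBl, dotvZr, dotvZl).
rewrite (dotvC ws g) (dotvC z g).
set G := dotv g g; set gz := dotv g z; set gs := dotv g ws; set gv := dotv g v.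
set fv := f v; set fs := f ws; set fw := f _.
set zz := dotv z z; set zs := dotv z ws; set sz := dotv ws z; set ss := dotv ws ws.
move=> hq hs; rewrite -subr_ge0.
(* The difference is a combination of the smoothness inequality with weight
   [t ^+ 2] and of the quasar convexity inequality with weight [2 * t]. *)
set D := (X in 0 <= X).
have -> : D = t ^+ 2 * (fv + - (1 / L) * G +
    L / 2 * (- (1 / L) * (- (1 / L) * G)) - fw) +
    2 * t * (fs - (fv + rho^-1 * (gs - gv))).
  rewrite /D; field; by rewrite !gt_eqF.
by rewrite addr_ge0// mulr_ge0// ?subr_ge0// ?sqr_ge0// mulr_ge0// ltW.
Qed.

End LyapunovStep.

(** * Mean changes over an exponential waiting time *)

Section LyapunovDrift.
Local Set Implicit Arguments.
Local Unset Strict Implicit.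

Lemma lyapunov_drift (R : realType) (n : nat) (f : 'rV[R]_n -> R)
    (ws : 'rV[R]_n) (L rho T : R) (w z : 'rV[R]_n) (u : R -> R) :
  (forall x, differentiable f x) -> global_minimizer f ws ->
  0 < L -> smooth L f -> 0 < rho -> quasar_convex rho f ws -> 0 <= T ->
  (forall s, u s = lyapunov f ws L rho (T + s)
    (mixed rho T (T + s) w z - (1 / L) *: grad f (mixed rho T (T + s) w z))
    (z - (rho * (T + s) / (2 * L)) *: grad f (mixed rho T (T + s) w z))) ->
  measurable_fun [set: R] u ->
  (\int[lebesgue_measure]_(s in `]0%R, +oo[) (u s * expR (- s))%:E
    <= (lyapunov f ws L rho T w z)%:E)%E.
Proof.
move=> df fmin L0 fL rho0 fq T0 uE mu.
have V0 t w' z' : 0 <= lyapunov f ws L rho t w' z' by exact: lyapunov_ge0.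
set C := 2 * L / rho ^+ 2 * dotv (z - ws) (z - ws).
have C0 : 0 <= C.
  by rewrite mulr_ge0 ?dotvv_ge0// divr_ge0 ?sqr_ge0// mulr_ge0// ltW.
pose q s := (T + s) ^+ 2 * (f (mixed rho T (T + s) w z) - f ws) + C.
have dq (s : R) : 0 <= s -> is_derive s 1 q _ :=
  fun s0 => is_derive_sqr_gap ws C w z df rho0 T0 s0.
apply: (@le_trans _ _ (q 0)%:E).
  apply: exponential_average_le => //.
  - by move=> s s0; rewrite addr_ge0// mulr_ge0 ?sqr_ge0// subr_ge0.
  - by move=> s s0; have [] := dq s s0.
  - move=> s s0; rewrite uE V0/=; have [_ ->] := dq s (ltW s0).
    by apply: lyapunov_step_le => //; rewrite ltr_wpDl.
rewrite lee_fin /q /lyapunov addr0 lerD2r.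
have [->|T1] := eqVneq T 0; first by rewrite expr0n/= !mul0r.
by rewrite /mixed divff// powR1 subrr scale0r addr0.
Qed.

(** The polynomial [q s = (a + s) ^+ 2 + 2 * (a + s) + 2] solves
    [q s - q^`() s = (a + s) ^+ 2], so that [q 0] is the exact mean. *)
Lemma centred_square_drift (R : realType) (T : R) (m : R) :
  (\int[lebesgue_measure]_(s in `]0%R, +oo[)
     ((T + s - (m + 1)) ^+ 2 * expR (- s))%:E <= ((T - m) ^+ 2 + 1)%:E)%E.
Proof.
pose a := T - (m + 1).
pose q s : R := (a + s) ^+ 2 + 2 * (a + s) + 2.
have dq (s : R) : is_derive s 1 q (2 * (a + s) + 2).
  have dD : is_derive s 1 (fun s : R => a + s) 1.
    have := is_deriveD (is_derive_cst a s 1) (is_derive_id s (1 : R)).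
    by rewrite add0r.
  have := is_deriveD (is_deriveD (is_deriveX 2 dD) (is_deriveZ 2 dD)) (is_derive_cst (2 : R) s 1).
  move=> [d1 d2]; apply: DeriveDef; first exact: d1.
  by rewrite [LHS]d2 /GRing.scale/=; ring.
have -> : (T - m) ^+ 2 + 1 = q 0 by rewrite /q /a; ring.
apply: (exponential_average_le (u := fun s => (T + s - (m + 1)) ^+ 2)).
- move=> s _; have -> : q s = (a + s + 1) ^+ 2 + 1 by rewrite /q; ring.
  by rewrite addr_ge0// sqr_ge0.
- by move=> s _; have [] := dq s.
- apply: measurable_funX; apply: measurable_funB => //.
  exact: measurable_funD.
- move=> s _; rewrite sqr_ge0/=; have [_ ->] := dq s.
  by rewrite le_eqVlt; apply/orP; left; apply/eqP; rewrite /q /a; ring.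
Qed.

Lemma measurable_superlevel d (T : measurableType d) (R : realType)
    (Y : T -> R) (a : R) :
  measurable_fun [set: T] Y -> measurable [set x | a <= Y x].
Proof. by move=> mY; rewrite -[X in measurable X]setTI; exact: measurable_fun_le. Qed.

Lemma measurable_strict_superlevel d (T : measurableType d) (R : realType)
    (Y : T -> R) (a : R) :
  measurable_fun [set: T] Y -> measurable [set x | a < Y x].
Proof.
move=> mY; rewrite (_ : [set x | _] = ~` [set x | Y x <= a]).
  by apply: measurableC; rewrite -[X in measurable X]setTI; exact: measurable_fun_le.
by apply/seteqP; split => x /=; rewrite ltNge => /negP.
Qed.

Lemma probability_ge_le d (Omega : measurableType d) (R : realType)
    (P : probability Omega R) (Y : Omega -> R) (a C : R) :
  measurable_fun [set: Omega] Y -> (forall om, 0 <= Y om) -> 0 < a ->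
  (\int[P]_om (Y om)%:E <= C%:E)%E ->
  (P [set om | (a <= Y om)%R] <= (C / a)%:E)%E.
Proof.
move=> mY Y0 a0 YC.
have mEY : measurable_fun [set: Omega] (EFin \o Y) by exact/measurable_EFinP.
have := le_integral_abse P measurableT mEY a0.
rewrite setTI (_ : [set x | _] = [set om | (a <= Y om)%R]); last first.
  by apply/seteqP; split => om /=; rewrite lee_fin ger0_norm.
rewrite (_ : (fun x => `|(EFin \o Y) x|%E) = (fun om => (Y om)%:E)); last first.
  by apply/funext => om /=; rewrite ger0_norm.
move=> /le_trans /(_ YC).
by rewrite EFinM lee_pdivlMr// muleC.
Qed.

(** Markov's inequality with a strict comparison, so that it also covers
    [C = 0], where [Y] vanishes almost surely. *)
Lemma probability_gt_le d (Omega : measurableType d) (R : realType)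
    (P : probability Omega R) (Y : Omega -> R) (a C : R) :
  measurable_fun [set: Omega] Y -> (forall om, 0 <= Y om) -> 0 < a -> 0 <= C ->
  (\int[P]_om (Y om)%:E <= C%:E)%E ->
  (P [set om | (a * C < Y om)%R] <= (1 / a)%:E)%E.
Proof.
move=> mY Y0 a0 C0 YC.
move: C0; rewrite le_eqVlt => /predU1P[C0|C0]; last first.
  apply: (@le_trans _ _ (P [set om | a * C <= Y om])).
    apply: le_measure; rewrite ?inE; last by move=> om /=; exact: ltW.
      exact: measurable_strict_superlevel.
    exact: measurable_superlevel.
  apply: (le_trans (probability_ge_le mY Y0 (mulr_gt0 a0 C0) YC)).
  by rewrite lee_fin invfM mulrCA divff ?gt_eqF// mulr1 mul1r.
have mEY : measurable_fun [set: Omega] (EFin \o Y) by exact/measurable_EFinP.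
have : (\int[P]_om `|(EFin \o Y) om| = 0)%E.
  rewrite (_ : (fun x => `|(EFin \o Y) x|%E) = (fun om => (Y om)%:E)); last first.
    by apply/funext => om /=; rewrite ger0_norm.
  apply/eqP; rewrite eq_le integral_ge0// ?andbT; last first.
    by move=> om _; rewrite lee_fin.
  by apply: (le_trans YC); rewrite -C0.
move=> /(ae_eq_integral_abs P measurableT mEY) [N [mN PN0 sub]].
apply: (@le_trans _ _ (P N)).
  apply: le_measure; rewrite ?inE//; first exact: measurable_strict_superlevel.
  move=> om /= Yom; apply: sub => /= /(_ I) [Y0'].
  by move: Yom; rewrite Y0' -C0 mulr0 ltxx.
by rewrite PN0 lee_fin divr_ge0// ltW.
Qed.

End LyapunovDrift.

(** * The algorithm as an iterated random map *)

Section StateChain.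
Local Set Implicit Arguments.
Local Unset Strict Implicit.

(** States are stored as tuples, which carry the product sigma-algebra of their
    coordinates, and are computed on as row vectors. *)
Definition row_of_tuple (R : realType) (n : nat) (x : n.-tuple R) : 'rV[R]_n :=
  \row_i tnth x i.

Definition tuple_of_row (R : realType) (n : nat) (v : 'rV[R]_n) : n.-tuple R :=
  [tuple v 0 i | i < n].

Lemma tuple_of_rowK (R : realType) (n : nat) :
  cancel (@tuple_of_row R n) (@row_of_tuple R n).
Proof. by move=> v; apply/rowP => i; rewrite mxE tnth_mktuple. Qed.

Lemma coord_measurable_row_of_tuple d (T : measurableType d) (R : realType)
    (n : nat) (g : T -> n.-tuple R) :
  measurable_fun [set: T] g -> coord_measurable (fun x => row_of_tuple (g x)).
Proof.
move=> mg i; under eq_fun do rewrite mxE.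
exact: (measurableT_comp (measurable_tnth i) mg).
Qed.

Lemma measurable_tuple_of_row d (T : measurableType d) (R : realType)
    (n : nat) (g : T -> 'rV[R]_n) :
  coord_measurable g -> measurable_fun [set: T] (fun x => tuple_of_row (g x)).
Proof.
move=> mg; apply/measurable_fun_tnthP => i.
rewrite (_ : _ \o _ = fun x => g x 0 i); first exact: mg.
by apply/funext => x /=; rewrite tnth_mktuple.
Qed.

(** Inversion is reduced to a power of the nonnegative number [g x ^+ 2], in a
    form that is also correct where [g x = 0]. *)
Lemma measurable_inverse d (T : measurableType d) (R : realType) (g : T -> R) :
  measurable_fun [set: T] g -> measurable_fun [set: T] (fun x => (g x)^-1).
Proof.
move=> mg; rewrite (_ : (fun x => _) = fun x => g x * (g x ^+ 2) `^ (-1)).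
  apply: measurable_funM => //; apply: (measurableT_comp (measurable_powR _)).
  exact: measurable_funX.
apply/funext => x; rewrite powR_inv1 ?sqr_ge0//.
have [->|gx] := eqVneq (g x) 0; first by rewrite invr0 mul0r.
by rewrite expr2 invfM mulrA divff// mul1r.
Qed.

Local Notation state R n := ((R * (n.-tuple R * n.-tuple R))%type).

Definition state_of (R : realType) (n : nat) (t : R) (w z : 'rV[R]_n) :
    state R n := (t, (tuple_of_row w, tuple_of_row z)).

Definition lyapunov_state (R : realType) (n : nat) (f : 'rV[R]_n -> R)
    (ws : 'rV[R]_n) (L rho : R) (x : state R n) : R :=
  lyapunov f ws L rho x.1 (row_of_tuple x.2.1) (row_of_tuple x.2.2).

Lemma lyapunov_state_of (R : realType) (n : nat) (f : 'rV[R]_n -> R)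
    (ws : 'rV[R]_n) (L rho t : R) (w z : 'rV[R]_n) :
  lyapunov_state f ws L rho (state_of t w z) = lyapunov f ws L rho t w z.
Proof. by rewrite /lyapunov_state /= !tuple_of_rowK. Qed.

Definition step (R : realType) (n : nat) (f : 'rV[R]_n -> R) (L rho : R)
    (xs : state R n * R) : state R n :=
  let t := xs.1.1 + xs.2 in
  let z := row_of_tuple xs.1.2.2 in
  let v := mixed rho xs.1.1 t (row_of_tuple xs.1.2.1) z in
  state_of t (v - (1 / L) *: grad f v)
    (z - (rho * t / (2 * L)) *: grad f v).

Lemma measurable_step (R : realType) (n : nat) (f : 'rV[R]_n -> R) (L rho : R) :
  (forall x, differentiable f x) ->
  measurable_fun [set: state R n * R] (step f L rho).
Proof.
move=> df.
have mt : measurable_fun [set: state R n * R]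
    (fun xs => xs.1.1 + xs.2).
  by apply: measurable_funD => //; exact: measurableT_comp.
have mw : coord_measurable
    (fun xs : state R n * R => row_of_tuple xs.1.2.1).
  apply: coord_measurable_row_of_tuple.
  by do 2 apply: measurableT_comp => //.
have mz : coord_measurable
    (fun xs : state R n * R => row_of_tuple xs.1.2.2).
  apply: coord_measurable_row_of_tuple.
  by do 2 apply: measurableT_comp => //.
have mv : coord_measurable (fun xs : state R n * R =>
    mixed rho xs.1.1 (xs.1.1 + xs.2) (row_of_tuple xs.1.2.1)
      (row_of_tuple xs.1.2.2)).
  apply: coord_measurableD => //; apply: coord_measurableZ; last first.
    exact: coord_measurableB.
  apply: measurable_funB => //.
  apply: (measurableT_comp (measurable_powR _)).
  apply: measurable_funM; first exact: measurableT_comp.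
  exact: measurable_inverse.
have mg := coord_measurable_grad df mv.
rewrite /step.
apply: measurable_fun_pair => //=.
apply: measurable_fun_pair => /=.
- apply: measurable_tuple_of_row; apply: coord_measurableB => //.
  exact: coord_measurableZ.
- apply: measurable_tuple_of_row; apply: coord_measurableB => //.
  apply: coord_measurableZ => //.
  by apply: measurable_funM => //; exact: measurable_funM.
Qed.

Lemma measurable_lyapunov d (T : measurableType d) (R : realType) (n : nat)
    (f : 'rV[R]_n -> R) (ws : 'rV[R]_n) (L rho : R) (t : T -> R)
    (w z : T -> 'rV[R]_n) :
  continuous f -> measurable_fun [set: T] t ->
  coord_measurable w -> coord_measurable z ->
  measurable_fun [set: T] (fun x => lyapunov f ws L rho (t x) (w x) (z x)).
Proof.
move=> cf mt mw mz.
have mzs : coord_measurable (fun x => z x - ws).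
  by apply: coord_measurableB => //; exact: coord_measurable_cst.
apply: measurable_funD; apply: measurable_funM => //.
- exact: measurable_funX.
- by apply: measurable_funB => //; exact: measurable_continuous_coord.
- exact: measurable_dotv.
Qed.

Lemma measurable_lyapunov_state (R : realType) (n : nat)
    (f : 'rV[R]_n -> R) (ws : 'rV[R]_n) (L rho : R) :
  (forall x, differentiable f x) ->
  measurable_fun [set: state R n] (lyapunov_state f ws L rho).
Proof.
move=> df; apply: measurable_lyapunov => //.
- by move=> x; exact: differentiable_continuous.
- by apply: coord_measurable_row_of_tuple; exact: measurableT_comp.
- by apply: coord_measurable_row_of_tuple; exact: measurableT_comp.
Qed.

(** A time close to its mean [m] is at least [(1 - c) * m], and the energy bound
    may then be divided by its square. *)
Lemma gap_le_lyapunov (R : realType) (n : nat) (f : 'rV[R]_n -> R)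
    (ws : 'rV[R]_n) (L rho c m t B : R) (w z : 'rV[R]_n) :
  global_minimizer f ws -> 0 < L -> 0 < rho -> 0 < c < 1 -> 0 < m -> 0 <= t ->
  (t - m) ^+ 2 < (c * m) ^+ 2 ->
  lyapunov f ws L rho t w z <= 2 * L / rho ^+ 2 * B ->
  f w - f ws <= 2 * L * B / ((1 - c) ^+ 2 * rho ^+ 2 * m ^+ 2).
Proof.
move=> fmin L0 rho0 /andP[c_gt0 c_lt1] m0 t0 tm tB.
rewrite ler_pdivlMr; last by rewrite !mulr_gt0 ?exprn_gt0 ?subr_gt0.
have gap0 : 0 <= f w - f ws by rewrite subr_ge0; exact: fmin.
move: tB gap0; rewrite /lyapunov; set gap := f w - f ws => tB gap0.
have tm1 : (1 - c) * m <= t.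
  rewrite leNgt; apply/negP => tm1; move: tm; apply/negP; rewrite -leNgt.
  by rewrite -[leRHS]sqrrN ler_sqr ?nnegrE; nra.
have tm2 : ((1 - c) * m) ^+ 2 <= t ^+ 2.
  by rewrite ler_sqr ?nnegrE// mulr_ge0 ?subr_ge0// ltW.
have K0 : 0 <= 2 * L / rho ^+ 2 by rewrite divr_ge0 ?sqr_ge0// mulr_ge0// ltW.
have : ((1 - c) * m) ^+ 2 * gap <= 2 * L / rho ^+ 2 * B.
  apply: le_trans tB; apply: (@le_trans _ _ (t ^+ 2 * gap)).
    exact: ler_wpM2r.
  by rewrite lerDl mulr_ge0// dotvv_ge0.
rewrite -(ler_pM2r (exprn_gt0 2 rho0)).
have -> : 2 * L / rho ^+ 2 * B * rho ^+ 2 = 2 * L * B.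
  by field; rewrite gt_eqF.
by apply: le_trans; rewrite le_eqVlt; apply/orP; left; apply/eqP; ring.
Qed.

End StateChain.

Section RandomProcess.
Local Set Implicit Arguments.
Local Unset Strict Implicit.
Local Notation state R n := ((R * (n.-tuple R * n.-tuple R))%type).
Context (R : realType) (n : nat) (f : 'rV[R]_n -> R) (ws : 'rV[R]_n).
Context (L rho : R) (dO : measure_display) (Omega : measurableType dO).
Context (P : probability Omega R) (T : nat -> {RV P >-> R}).
Context (T_exp : exponential_times T).
Context (w0 z0 : 'rV[R]_n) (v w z : nat -> Omega -> 'rV[R]_n).
Context (f_diff : forall x : 'rV[R]_n, differentiable f x).
Context (f_min : global_minimizer f ws).
Context (L_gt0 : 0 < L) (f_smooth : smooth L f).
Context (rho_gt0 : 0 < rho) (f_quasar : quasar_convex rho f ws).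
Context (algo : forall om : Omega,
  discrete_algorithm f
    (fun k => 1 - (T k om / T k.+1 om) `^ (2 / rho))
    (fun _ => 0)
    (fun _ => 1 / L)
    (fun k => rho * T k om / (2 * L))
    w0 z0 (v ^~ om) (w ^~ om) (z ^~ om)).

Let increment j om := T j.+1 om - T j om.

Let measurable_increment j : measurable_fun [set: Omega] (increment j).
Proof. exact: measurable_funB. Qed.

Lemma times_ge0 j om : 0 <= T j om.
Proof.
have [T0 Tlt _ _] := T_exp.
by elim: j => [|j IH]; [rewrite T0|exact: le_trans IH (ltW (Tlt _ _))].
Qed.

(** The times themselves form an iterated random map, with addition as the
    map; each step adds at most the variance [1]. *)
Lemma expected_sqr_deviation_le j :
  (\int[P]_om ((T j om - j%:R) ^+ 2)%:E <= j%:R%:E)%E.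
Proof.
have [T0 _ indT expT] := T_exp.
have TS i om : T i.+1 om = T i om + increment i om.
  by rewrite /increment addrC subrK.
have mF : measurable_fun [set: R * R] (fun ts => ts.1 + ts.2).
  exact: measurable_funD.
pose W i (t : R) := (t - i%:R) ^+ 2.
have mW i : measurable_fun [set: R] (W i).
  by apply: measurable_funX; exact: measurable_funB.
elim: j => [|j IH].
  under eq_integral do rewrite T0 subrr expr0n.
  by rewrite integral_cst// mul0e.
have mW1 : measurable_fun [set: R] (fun t => W j t + 1) by exact: measurable_funD.
apply: (@le_trans _ _ (\int[P]_om (W j (T j om) + 1)%:E)%E).
  apply: (iterated_drift_le mF measurable_increment indT expT T0 TS
    mW1 (mW j.+1)) => [t|om]; first exact: sqr_ge0.
  apply: le_trans (centred_square_drift (T j om) j%:R).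
  rewrite le_eqVlt; apply/orP; left; apply/eqP; apply: eq_integral => s _.
  by rewrite /W/= -natr1.
under eq_integral do rewrite EFinD.
rewrite ge0_integralD//; last 2 first.
- by move=> om _; rewrite lee_fin sqr_ge0.
- by apply/measurable_EFinP; exact: (measurableT_comp (mW j)).
rewrite integral_cst// [X in (_ * X)%E](probability_setT P) mule1 -natr1 EFinD.
exact: leeD2r.
Qed.

Let process j om := state_of (T j om) (w j om) (z j om).

Let process0 om : process 0%N om = state_of 0 w0 z0.
Proof.
have [T0 _ _ _] := T_exp; have [w_0 z_0 _] := algo om.
by rewrite /process T0 w_0 z_0.
Qed.

Let processS j om :
  process j.+1 om = step f L rho (process j om, increment j om).
Proof.
have [_ _ /(_ j)[vE wE zE]] := algo om.
rewrite /step/= !tuple_of_rowK /increment addrC subrK.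
by rewrite /process wE zE scale0r addr0 [v j om]vE.
Qed.

Let measurable_process j : measurable_fun [set: Omega] (process j).
Proof.
exact: (measurable_iterated (measurable_step L rho f_diff)
  measurable_increment process0 processS).
Qed.

Lemma measurable_gap j : measurable_fun [set: Omega] (fun om => f (w j om)).
Proof.
apply: measurable_continuous_coord.
  by move=> x; exact: differentiable_continuous.
have := measurableT_comp measurable_fst
  (measurableT_comp measurable_snd (measurable_process j)).
move=> /coord_measurable_row_of_tuple; congr coord_measurable.
by apply/funext => om /=; rewrite tuple_of_rowK.
Qed.

Lemma measurable_lyapunov_process j : measurable_fun [set: Omega]
  (fun om => lyapunov f ws L rho (T j om) (w j om) (z j om)).
Proof.
have := measurableT_comp (measurable_lyapunov_state ws L rho f_diff)
  (measurable_process j).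
by congr measurable_fun; apply/funext => om /=; rewrite lyapunov_state_of.
Qed.

(** The energy is a supermartingale, and the term in [f] is absent at the start
    because [T 0 = 0]. *)
Lemma expected_lyapunov_le j :
  (\int[P]_om (lyapunov f ws L rho (T j om) (w j om) (z j om))%:E <=
   (2 * L / rho ^+ 2 * dotv (z0 - ws) (z0 - ws))%:E)%E.
Proof.
have [T0 _ indT expT] := T_exp.
have mV := measurable_lyapunov_state ws L rho f_diff.
have mF := measurable_step L rho f_diff.
elim: j => [|j IH].
  under eq_integral => om _.
    rewrite -lyapunov_state_of -/(process 0%N om) process0.
    over.
  rewrite integral_cst// [X in (_ * X)%E](probability_setT P) mule1 lee_fin.
  by rewrite lyapunov_state_of /lyapunov expr0n mul0r add0r.
apply: le_trans IH.
under eq_integral do rewrite -lyapunov_state_of.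
under [leRHS]eq_integral do rewrite -lyapunov_state_of.
apply: (iterated_drift_le mF measurable_increment indT expT process0 processS
  mV mV).
  by move=> x; exact: lyapunov_ge0.
move=> om; rewrite lyapunov_state_of.
apply: (lyapunov_drift (u := fun s =>
    lyapunov_state f ws L rho (step f L rho (process j om, s)))
  f_diff f_min L_gt0 f_smooth rho_gt0 f_quasar (times_ge0 j om)).
  by move=> s; rewrite lyapunov_state_of /= !tuple_of_rowK.
apply: (measurableT_comp mV); apply: (measurableT_comp mF).
exact: measurable_pair1.
Qed.

End RandomProcess.

(** * The high-probability bound *)

Theorem corollary1 (R : realType) (n : nat) (f : 'rV[R]_n -> R)
    (ws : 'rV[R]_n) (L rho : R)
    (f_diff : forall x : 'rV[R]_n, differentiable f x)
    (f_min : global_minimizer f ws)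
    (L_gt0 : 0 < L) (f_smooth : smooth L f)
    (rho_gt0 : 0 < rho) (f_quasar : quasar_convex rho f ws)
    (dO : measure_display) (Omega : measurableType dO)
    (P : probability Omega R) (T : nat -> {RV P >-> R})
    (T_exp : exponential_times T)
    (w0 z0 : 'rV[R]_n) (v w z : nat -> Omega -> 'rV[R]_n)
    (algo : forall om : Omega,
       discrete_algorithm f
         (fun k => 1 - (T k om / T k.+1 om) `^ (2 / rho))
         (fun _ => 0)
         (fun _ => 1 / L)
         (fun k => rho * T k om / (2 * L))
         w0 z0 (v ^~ om) (w ^~ om) (z ^~ om)) :
  forall (k : nat) (c c0 : R), (1 <= k)%N -> 0 < c < 1 -> 1 < c0 ->
    let good := [set om : Omega |
      f (w k om) - f ws <=
        2 * c0 * L * enorm (z0 - ws) ^+ 2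
          / ((1 - c) ^+ 2 * rho ^+ 2 * k%:R ^+ 2)] in
    measurable good /\
    ((1 - 1 / (c ^+ 2 * k%:R) - 1 / c0)%:E <= P good)%E.
Proof.
move=> k c c0 k1 /andP[c_gt0 c_lt1] c0_gt1 good.
have k0 : 0 < k%:R :> R by rewrite ltr0n.
have c0_gt0 : 0 < c0 by apply: lt_trans c0_gt1.
have mgood : measurable good.
  rewrite /good; set b := _ / _.
  rewrite (_ : [set om | _] = [set om | - b - f ws <= - f (w k om)]).
    apply: measurable_superlevel; apply: measurable_funN.
    exact: (measurable_gap T_exp f_diff algo).
  by apply/seteqP; split => om /= h; lra.
split => //.
pose W om := (T k om - k%:R) ^+ 2.
pose V om := lyapunov f ws L rho (T k om) (w k om) (z k om).
pose C := 2 * L / rho ^+ 2 * dotv (z0 - ws) (z0 - ws).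
have C0 : 0 <= C.
  by rewrite mulr_ge0 ?dotvv_ge0// divr_ge0 ?sqr_ge0// mulr_ge0// ltW.
have mW : measurable_fun [set: Omega] W.
  by apply: measurable_funX; exact: measurable_funB.
have mV : measurable_fun [set: Omega] V.
  exact: (measurable_lyapunov_process _ T_exp f_diff algo).
pose early := [set om | (c * k%:R) ^+ 2 <= W om].
pose large := [set om | c0 * C < V om].
have P_early : (P early <= (1 / (c ^+ 2 * k%:R))%:E)%E.
  have ck : 0 < (c * k%:R) ^+ 2 by rewrite exprn_gt0// mulr_gt0.
  have EW := expected_sqr_deviation_le T_exp k.
  apply: le_trans (probability_ge_le mW _ ck EW) _.
    by move=> om; exact: sqr_ge0.
  rewrite lee_fin le_eqVlt; apply/orP; left; apply/eqP.
  by field; rewrite !gt_eqF.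
have P_large : (P large <= (1 / c0)%:E)%E.
  apply: probability_gt_le C0 _ => //.
    by move=> om; exact: lyapunov_ge0.
  exact: (expected_lyapunov_le T_exp f_diff f_min L_gt0 f_smooth rho_gt0
    f_quasar algo).
have m_early : measurable early by exact: measurable_superlevel.
have m_large : measurable large by exact: measurable_strict_superlevel.
have sub : ~` good `<=` early `|` large.
  move=> om /= bad.
  have [h1|h1] := leP ((c * k%:R) ^+ 2) (W om); first by left.
  have [h2|h2] := ltP (c0 * C) (V om); first by right.
  exfalso; apply: bad; rewrite /good/= enorm_sqr.
  rewrite -[2 * c0 * L]mulrAC -[2 * L * c0 * _]mulrA.
  apply: gap_le_lyapunov h1 _ => //; first by rewrite c_gt0.
    exact: times_ge0.
  by rewrite [leRHS]mulrCA; exact: h2.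
have : (P (~` good) <= (1 / (c ^+ 2 * k%:R) + 1 / c0)%:E)%E.
  apply: (@le_trans _ _ (P (early `|` large))).
    apply: le_measure => //; rewrite inE; first exact: measurableC.
    exact: measurableU.
  apply: (le_trans (measureU2 _ m_early m_large)).
  by rewrite EFinD; exact: leeD.
rewrite probability_setC// -(fineK (fin_num_measure P good mgood)) -EFinB !lee_fin.
lra.
Qed.
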